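(* Let $G$ be a finite group, $n\ge3$, $x=(x_0,X)\in\mathsf{M}_{0,n+1}$, $\mathscr{B}$ a geometric basis of $N_x$ and $\theta:\Gamma_n\to G$ an $n$-datum. If $G$ is abelian, then there exists $a\in\mathcal{I}(x,\mathscr{B},\theta)$ such that $Y_a=\mathsf{M}_{0,n}$.
   Context: $\Gamma_n=\langle\gamma_1,\dots,\gamma_n\mid\gamma_1\cdots\gamma_n=1\rangle$. An $n$-datum is an epimorphism $\theta:\Gamma_n\to G$ with $\theta(\gamma_i)\ne1$ for all $i$. $\mathsf{M}_{0,n}$ is the set of $n$-tuples $X=(x_1,\dots,x_n)$ of distinct points of $\mathbb{P}^1=\mathbb{P}^1(\mathbb C)$ with $x_{n-2}=0,x_{n-1}=1,x_n=\infty$; $\mathsf{M}_{0,n+1}=\{x=(x_0,X):X\in\mathsf{M}_{0,n},\ x_0\in\mathbb{P}^1-X\}$, where $\mathbb{P}^1-X=\mathbb{P}^1-\{x_1,\dots,x_n\}$; $p:\mathsf{M}_{0,n+1}\to\mathsf{M}_{0,n}$, $p(x_0,X)=X$, is a fibre bundle. Put $N_x=\pi_1(\mathbb{P}^1-X,x_0)$, $K_x=\pi_1(\mathsf{M}_{0,n+1},x)$, $H_X=\pi_1(\mathsf{M}_{0,n},X)$; there is a split exact sequence $1\to N_x\xrightarrow{i_*}K_x\xrightarrow{p_*}H_X\to1$, with $i$ the inclusion of the fibre. Geometric basis of $N_x$: choose a permutation $\sigma$ and smooth embedded arcs $\tilde\alpha_i$ from $x_0$ to $x_{\sigma(i)}$,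 meeting only at $x_0$, with distinct tangent vectors at $x_0$ in counterclockwise order; $\alpha_i$ is the loop going along $\tilde\alpha_i$ to the boundary of a small disc around $x_{\sigma(i)}$, once counterclockwise around it, and back (discs disjoint, each containing no other $x_j$). $\mathscr{B}=\{[\alpha_1],\dots,[\alpha_n]\}$ induces an isomorphism $\chi:\Gamma_n\to N_x$, $\chi(\gamma_i)=[\alpha_i]$ (paths composed left to right). $\mathcal{I}(x,\mathscr{B},\theta)$ is the set of pairs $a=(H_a,f_a)$ with $H_a\subset H_X$ a finite index subgroup and $f_a:K_a:=p_*^{-1}(H_a)\to G$ a morphism with $f_a\circ i_*=\theta\circ\chi^{-1}$. For $a\in\mathcal{I}(x,\mathscr{B},\theta)$, $q_a:(Y_a,y_a)\to(\mathsf{M}_{0,n},X)$ is the connected pointed covering with $q_{a*}\pi_1(Y_a,y_a)=H_a$. Thus $Y_a=\mathsf{M}_{0,n}$ (i.e. $q_a$ is an isomorphism) means exactly $H_a=H_X$. *)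

(* Defs.v *)
From HB Require Import structures.
From mathcomp Require Import all_boot all_order all_algebra all_fingroup.
From mathcomp Require Import generic_quotient complex ring lra.
From mathcomp Require Import all_classical all_reals all_analysis.

Set Implicit Arguments.
Unset Strict Implicit.
Unset Printing Implicit Defensive.

Import Order.TTheory GRing.Theory Num.Theory.
Import numFieldNormedType.Exports.

Local Open Scope classical_set_scope.
Local Open Scope ring_scope.
Local Open Scope quotient_scope.

Section path_operations.
Context {R : realType} {T : Type}.

Definition path_cat (f g : R -> T) (t : R) : T :=
  if t <= 2^-1 then f (2 * t) else g (2 * t - 1).

Definition path_rev (f : R -> T) (t : R) : T := f (1 - t).

End path_operations.

(* Values outside [0, 1] are irrelevant: two loops that agree on [0, 1] are
   homotopic. *)
Record loop (R : realType) (T : topologicalType) (x : T) := Loop {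
  loop_fun :> R -> T;
  loop_cont : {within `[0, 1], continuous loop_fun};
  loop0 : loop_fun 0 = x;
  loop1 : loop_fun 1 = x
}.

HB.instance Definition _ (R : realType) (T : topologicalType) (x : T) :=
  gen_eqMixin (loop R x).
HB.instance Definition _ (R : realType) (T : topologicalType) (x : T) :=
  gen_choiceMixin (loop R x).

Definition homotopic (R : realType) (T : topologicalType) (x : T)
    (f g : loop R x) : Prop :=
  exists H : R * R -> T,
    [/\ {within `[0, 1] `*` `[0, 1], continuous H},
        forall t : R, t \in `[0, 1] -> H (0, t) = f t,
        forall t : R, t \in `[0, 1] -> H (1, t) = g t &
        forall s : R, s \in `[0, 1] -> H (s, 0) = x /\ H (s, 1) = x].

Section continuity_rules.
Context {R : realType} {X Y Z : topologicalType}.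

Lemma cont_cst (y : Y) : continuous (fun _ : X => y).
Proof. by move=> ?; exact: cvg_cst. Qed.

Lemma cont_id : continuous (fun x : X => x).
Proof. by move=> ?; exact: cvg_id. Qed.

Lemma cont_comp (f : X -> Y) (g : Y -> Z) :
  continuous f -> continuous g -> continuous (fun x => g (f x)).
Proof. by move=> cf cg x; apply: continuous_comp; [exact: cf|exact: cg]. Qed.

Lemma cont_pair (f : X -> Y) (g : X -> Z) :
  continuous f -> continuous g -> continuous (fun x => (f x, g x)).
Proof. by move=> cf cg x; apply: cvg_pair; [exact: cf|exact: cg]. Qed.

Lemma cont_fst : continuous (fun p : Y * Z => p.1).
Proof. by move=> p; exact: cvg_fst. Qed.

Lemma cont_snd : continuous (fun p : Y * Z => p.2).
Proof. by move=> p; exact: cvg_snd. Qed.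

Lemma cont_add (f g : X -> R) :
  continuous f -> continuous g -> continuous (fun x => f x + g x).
Proof. by move=> cf cg x; apply: (@cvgD _ R^o); [exact: cf|exact: cg]. Qed.

Lemma cont_opp (f : X -> R) : continuous f -> continuous (fun x => - f x).
Proof. by move=> cf x; apply: (@cvgN _ R^o); exact: cf. Qed.

Lemma cont_mul (f g : X -> R) :
  continuous f -> continuous g -> continuous (fun x => f x * g x).
Proof. by move=> cf cg x; apply: cvgM; [exact: cf|exact: cg]. Qed.

Lemma cont_max (f g : X -> R) :
  continuous f -> continuous g -> continuous (fun x => Num.max (f x) (g x)).
Proof. by move=> cf cg x; apply: continuous_max; [exact: cf|exact: cg]. Qed.

Lemma cont_min (f g : X -> R) :
  continuous f -> continuous g -> continuous (fun x => Num.min (f x) (g x)).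
Proof. by move=> cf cg x; apply: continuous_min; [exact: cf|exact: cg]. Qed.

End continuity_rules.

Local Ltac solve_cont :=
  first [assumption | lazymatch goal with
  | |- continuous (fun p => _ + _) => apply: cont_add; solve_cont
  | |- continuous (fun p => - _) => apply: cont_opp; solve_cont
  | |- continuous (fun p => _ * _) => apply: cont_mul; solve_cont
  | |- continuous (fun p => Num.max _ _) => apply: cont_max; solve_cont
  | |- continuous (fun p => Num.min _ _) => apply: cont_min; solve_cont
  | |- continuous (fun p => (_, _)) => apply: cont_pair; solve_cont
  | |- continuous -%R => apply: cont_opp; solve_cont
  | |- continuous ( *%R _) => apply: cont_mul; solve_cont
  | |- _ => first [exact: cont_fst | exact: cont_snd | exact: cont_id
                  | exact: cont_cst]
  end].

Section clamp.
Context {R : realType}.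

Definition clamp (t : R) : R := Num.max 0 (Num.min t 1).

Lemma clamp_itv t : clamp t \in `[0, 1].
Proof. by rewrite in_itv /= /clamp le_max ge_max lexx ler01 ge_min lexx orbT. Qed.

Lemma clampE t : t \in `[0, 1] -> clamp t = t.
Proof.
by rewrite in_itv /= => /andP[t0 t1]; rewrite /clamp min_l // max_r.
Qed.

Lemma clamp_le0 t : t <= 0 -> clamp t = 0.
Proof. by move=> t0; rewrite /clamp max_l // ge_min t0. Qed.

Lemma clamp_ge1 t : 1 <= t -> clamp t = 1.
Proof. by move=> t1; rewrite /clamp min_r // max_r. Qed.

Lemma continuous_clamp : continuous clamp.
Proof. by rewrite /clamp; solve_cont. Qed.

End clamp.

Section topology_lemmas.
Context {X T : topologicalType}.

Lemma continuous_retract (A : set X) (r : X -> X) (f : X -> T) :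
  continuous r -> (forall x, A (r x)) -> {within A, continuous f} ->
  continuous (f \o r).
Proof.
move=> cr Ar /subspace_continuousP cf x U /= /(cf _ (Ar x)) /cr.
by rewrite /nbhs /= => H; near=> y; apply: (near H y) => //.
Unshelve. all: by end_near. Qed.

Lemma within_continuous_eq (A : set X) (f g : X -> T) :
  (forall x, A x -> f x = g x) -> continuous f -> {within A, continuous g}.
Proof.
move=> fg cf; have cfA : {within A, continuous f} by apply: continuous_subspaceT.
by apply: subspace_eq_continuous cfA => x /set_mem; exact: fg.
Qed.

Lemma continuous_paste (R : realType) (phi : X -> R) (c : R) (F G : X -> T) :
  continuous phi -> continuous F -> continuous G ->
  (forall x, phi x = c -> F x = G x) ->
  continuous (fun x => if phi x <= c then F x else G x).
Proof.
move=> cphi cF cG FG; apply/continuous_subspace_setT.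
have -> : [set: X] = (phi @^-1` [set y | y <= c]) `|` (phi @^-1` [set y | c <= y]).
  by apply/esym/seteqP; split => // x _ /=; apply/orP; exact: le_total.
apply: withinU_continuous.
- by move/continuous_closedP : cphi; apply; exact: closed_le.
- by move/continuous_closedP : cphi; apply; exact: closed_ge.
- by apply: (within_continuous_eq _ cF) => x /= ->.
- apply: (within_continuous_eq _ cG) => x /= cx.
  by case: ifPn => // xc; rewrite FG //; apply/eqP; rewrite eq_le xc.
Qed.

End topology_lemmas.

Section homotopy.
Context {R : realType} {T : topologicalType} {x : T}.
Implicit Types f g h : loop R x.

Local Notation lc f := (f \o clamp).

Lemma lc_cont f : continuous (lc f).
Proof.
apply: (continuous_retract continuous_clamp _ (@loop_cont _ _ _ f)) => t.
exact: clamp_itv.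
Qed.

Lemma lcE f t : t \in `[0, 1] -> lc f t = f t.
Proof. by move=> t01; rewrite /= clampE. Qed.

Lemma lc_le0 f t : t <= 0 -> lc f t = x.
Proof. by move=> t0; rewrite /= clamp_le0 // loop0. Qed.

Lemma lc_ge1 f t : 1 <= t -> lc f t = x.
Proof. by move=> t1; rewrite /= clamp_ge1 // loop1. Qed.

Definition clamp2 (p : R * R) : R * R := (clamp p.1, clamp p.2).

Lemma continuous_clamp2 : continuous clamp2.
Proof.
by apply: cont_pair; (apply: cont_comp; last exact: continuous_clamp); solve_cont.
Qed.

Lemma homotopic_ext f g (H : R * R -> T) : continuous H ->
  (forall t : R, t \in `[0, 1] -> H (0, t) = f t) ->
  (forall t : R, t \in `[0, 1] -> H (1, t) = g t) ->
  (forall s : R, s \in `[0, 1] -> H (s, 0) = x /\ H (s, 1) = x) ->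
  homotopic f g.
Proof. by move=> cH Hf Hg Hx; exists H; split => //; exact: continuous_subspaceT. Qed.

Lemma homotopic_global f g : homotopic f g ->
  exists H : R * R -> T,
    [/\ continuous H,
        forall s t, H (s, t) = H (clamp s, clamp t),
        forall t : R, t \in `[0, 1] -> H (0, t) = f t,
        forall t : R, t \in `[0, 1] -> H (1, t) = g t &
        forall s, H (s, 0) = x /\ H (s, 1) = x].
Proof.
move=> [H [cH Hf Hg Hx]]; exists (H \o clamp2); split.
- apply: continuous_retract continuous_clamp2 _ cH => p.
  by split => /=; exact: clamp_itv.
- by move=> s t; rewrite /= /clamp2 /= !(clampE (clamp_itv _)).
- by move=> t t01; rewrite /= /clamp2 /= clamp_le0 // clampE // Hf.
- by move=> t t01; rewrite /= /clamp2 /= clamp_ge1 // clampE // Hg.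
- move=> s; rewrite /= /clamp2 /= (clamp_le0 (lexx 0)) (clamp_ge1 (lexx 1)).
  exact/Hx/clamp_itv.
Qed.

Let in01 (t : R) : (t \in `[0, 1]) = (0 <= t <= 1).
Proof. by rewrite in_itv. Qed.

Lemma homotopic_reparam (f g h : loop R x) (phi psi : R -> R) :
  continuous phi -> continuous psi ->
  phi 0 = psi 0 -> phi 1 = psi 1 ->
  (forall t : R, t \in `[0, 1] -> g t = lc f (phi t)) ->
  (forall t : R, t \in `[0, 1] -> h t = lc f (psi t)) ->
  homotopic g h.
Proof.
move=> cphi cpsi e0 e1 gE hE.
pose H (p : R * R) := lc f ((1 - p.1) * phi p.2 + p.1 * psi p.2).
apply: (@homotopic_ext _ _ H).
- apply: (@cont_comp _ _ _ (fun p : R * R => (1 - p.1) * phi p.2 + p.1 * psi p.2)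
    (lc f)); last exact: (@lc_cont f).
  have c1 := cont_comp (@cont_snd R R) cphi.
  have c2 := cont_comp (@cont_snd R R) cpsi.
  by solve_cont.
- by move=> t t01; rewrite /H /= subr0 mul1r mul0r addr0 gE.
- by move=> t t01; rewrite /H /= subrr mul1r mul0r add0r hE.
- have i0 : (0 : R) \in `[0, 1] by rewrite in01 lexx ler01.
  have i1 : (1 : R) \in `[0, 1] by rewrite in01 lexx ler01.
  move=> s _; rewrite /H /= -e0 -e1 -!mulrDl subrK !mul1r.
  split.
  + by have := gE 0 i0; rewrite /= loop0.
  + by have := gE 1 i1; rewrite /= loop1.
Qed.

Lemma homotopic_refl f : homotopic f f.
Proof. by apply: (@homotopic_reparam f f f id id) => //; try exact: cont_id; move=> t t01; rewrite lcE. Qed.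

Lemma homotopic_sym f g : homotopic f g -> homotopic g f.
Proof.
move=> /homotopic_global[H [cH _ Hf Hg Hx]].
apply: (@homotopic_ext _ _ (fun p => H (1 - p.1, p.2))).
- by apply: (cont_comp _ cH); solve_cont.
- by move=> t t01 /=; rewrite subr0 Hg.
- by move=> t t01 /=; rewrite subrr Hf.
- by move=> s s01 /=; exact: Hx.
Qed.

Lemma homotopic_trans f g h :
  homotopic f g -> homotopic g h -> homotopic f h.
Proof.
move=> /homotopic_global[H [cH Hc Hf Hg Hx]].
move=> /homotopic_global[K [cK Kc Kg Kh Kx]].
apply: (@homotopic_ext _ _ (fun p : R * R => if p.1 <= 2^-1
  then H (2 * p.1, p.2) else K (2 * p.1 - 1, p.2))).
- apply: (@continuous_paste _ _ _ fst).
  + exact: cont_fst.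
  + by apply: (cont_comp _ cH); solve_cont.
  + by apply: (cont_comp _ cK); solve_cont.
  + move=> [s t] /= ->; rewrite divff // subrr Hc Kc (clamp_ge1 (lexx 1)) (clamp_le0 (lexx 0)).
    by rewrite Hg ?clamp_itv // Kg ?clamp_itv.
- by move=> t t01 /=; rewrite invr_ge0 ler0n mulr0 Hf.
- move=> t t01 /=; rewrite ifF; last by apply/negbTE; rewrite -ltNge; lra.
  by rewrite (_ : 2 * 1 - 1 = 1) ?Kh //; lra.
- by move=> s s01 /=; case: ifP => _; [exact: Hx|exact: Kx].
Qed.

Lemma homotopic_eq f g : (forall t : R, t \in `[0, 1] -> f t = g t) -> homotopic f g.
Proof.
move=> fg; apply: (@homotopic_reparam f f g id id) => //; try exact: cont_id; move=> t t01; rewrite lcE //.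
by rewrite fg.
Qed.

Program Definition loop_cst : loop R x := @Loop R T x (cst x) _ _ _.
Next Obligation. by apply: continuous_subspaceT => ?; exact: cvg_cst. Qed.
Next Obligation. by []. Qed.
Next Obligation. by []. Qed.

Lemma path_catE f g t : t \in `[0, 1] ->
  path_cat f g t = path_cat (lc f) (lc g) t.
Proof.
rewrite in01 => /andP[t0 t1]; rewrite /path_cat; case: ifPn => [tle|].
  by rewrite lcE // in01; lra.
by rewrite -ltNge => tgt; rewrite lcE // in01; lra.
Qed.

Lemma path_cat_cont f g : continuous (path_cat (lc f) (lc g)).
Proof.
apply: (@continuous_paste _ _ _ id).
- exact: cont_id.
- by apply: (cont_comp _ (@lc_cont f)); solve_cont.
- by apply: (cont_comp _ (@lc_cont g)); solve_cont.
- by move=> t ->; rewrite divff // subrr lc_ge1 // lc_le0.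
Qed.

Program Definition loop_cat f g : loop R x := @Loop R T x (path_cat f g) _ _ _.
Next Obligation.
move=> f g; apply: (within_continuous_eq _ (path_cat_cont (f:=f) (g:=g))).
by move=> t t01; rewrite -path_catE.
Qed.
Next Obligation.
by move=> f g; rewrite /path_cat invr_ge0 ler0n mulr0 loop0.
Qed.
Next Obligation.
move=> f g; rewrite /path_cat ifF; last by apply/negbTE; rewrite -ltNge; lra.
by rewrite (_ : 2 * 1 - 1 = 1) ?loop1 //; lra.
Qed.

Program Definition loop_rev f : loop R x := @Loop R T x (path_rev f) _ _ _.
Next Obligation.
move=> f; apply: (@within_continuous_eq _ _ _ (fun t : R => lc f (1 - t))).
  move=> t t01; have : t \in `[0, 1] by []; rewrite in01 => /andP[t0 t1].
  by rewrite /path_rev -lcE // in01; lra.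
by apply: (cont_comp _ (@lc_cont f)); solve_cont.
Qed.
Next Obligation. by move=> f; rewrite /path_rev subr0 loop1. Qed.
Next Obligation. by move=> f; rewrite /path_rev subrr loop0. Qed.

Lemma loop_cat_homotopic f f' g g' : homotopic f f' -> homotopic g g' ->
  homotopic (loop_cat f g) (loop_cat f' g').
Proof.
move=> /homotopic_global[H [cH Hc Hf Hf' Hx]].
move=> /homotopic_global[K [cK Kc Kg Kg' Kx]].
apply: (@homotopic_ext _ _ (fun p : R * R => if p.2 <= 2^-1
  then H (p.1, 2 * p.2) else K (p.1, 2 * p.2 - 1))).
- apply: (@continuous_paste _ _ _ snd).
  + exact: cont_snd.
  + by apply: (cont_comp _ cH); solve_cont.
  + by apply: (cont_comp _ cK); solve_cont.
  + by move=> [s t] /= ->; rewrite divff // subrr (Hx s).2 (Kx s).1.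
- move=> t; rewrite in01 /= /path_cat => /andP[t0 t1]; case: ifPn => [tle|].
    by rewrite Hf // in01; lra.
  by rewrite -ltNge => tgt; rewrite Kg // in01; lra.
- move=> t; rewrite in01 /= /path_cat => /andP[t0 t1]; case: ifPn => [tle|].
    by rewrite Hf' // in01; lra.
  by rewrite -ltNge => tgt; rewrite Kg' // in01; lra.
- move=> s s01 /=; rewrite invr_ge0 ler0n mulr0 (Hx s).1; split => //.
  rewrite ifF; last by apply/negbTE; rewrite -ltNge; lra.
  by rewrite (_ : 2 * 1 - 1 = 1) ?(Kx s).2 //; lra.
Qed.

Lemma loop_rev_homotopic f f' : homotopic f f' ->
  homotopic (loop_rev f) (loop_rev f').
Proof.
move=> /homotopic_global[H [cH Hc Hf Hf' Hx]].
apply: (@homotopic_ext _ _ (fun p : R * R => H (p.1, 1 - p.2))).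
- by apply: (cont_comp _ cH); solve_cont.
- by move=> t; rewrite in01 => /andP[t0 t1] /=; rewrite Hf // in01; lra.
- by move=> t; rewrite in01 => /andP[t0 t1] /=; rewrite Hf' // in01; lra.
- by move=> s _ /=; rewrite subr0 subrr; split; [exact: (Hx s).2|exact: (Hx s).1].
Qed.

Lemma loop_catA f g h :
  homotopic (loop_cat f (loop_cat g h)) (loop_cat (loop_cat f g) h).
Proof.
pose phi (t : R) := Num.max (2^-1 * t) (Num.max (t - 4^-1) (2 * t - 1)).
apply: (@homotopic_reparam (loop_cat (loop_cat f g) h) _ _ phi id) => //.
- by rewrite /phi; solve_cont.
- exact: cont_id.
- by rewrite /phi max_l ?ge_max; lra.
- by rewrite /phi max_r; [rewrite max_r; lra|rewrite le_max; lra].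
- move=> t; rewrite in01 => /andP[t0 t1].
  have phi01 : phi t \in `[0, 1].
    rewrite in01 /phi; apply/andP; split.
      by rewrite le_max; apply/orP; left; lra.
    by rewrite !ge_max; apply/andP; split; [|apply/andP; split]; lra.
  rewrite lcE // /= /path_cat; case: (leP t 2^-1) => t12.
    have -> : phi t = 2^-1 * t by rewrite /phi max_l // ge_max; lra.
    rewrite ifT; last by lra.
    rewrite ifT; last by lra.
    by congr (f _); lra.
  case: (leP (2 * t - 1) 2^-1) => t34.
    have -> : phi t = t - 4^-1.
      by rewrite /phi max_r ?le_max; [rewrite max_l|]; lra.
    rewrite ifT; last by lra.
    rewrite ifF; last by apply/negbTE; rewrite -ltNge; lra.
    by congr (g _); lra.
  have -> : phi t = 2 * t - 1.
    by rewrite /phi max_r ?le_max; [rewrite max_r|]; lra.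
  rewrite ifF; last by apply/negbTE; rewrite -ltNge; lra.
  by congr (h _); lra.
- by move=> t t01; rewrite lcE.
Qed.

Lemma loop_cat_cst f : homotopic (loop_cat f loop_cst) f.
Proof.
pose phi (t : R) := Num.min (2 * t) 1.
apply: (@homotopic_reparam f _ _ phi id) => //.
- by rewrite /phi; solve_cont.
- exact: cont_id.
- by rewrite /phi mulr0 min_l.
- by rewrite /phi min_r //; lra.
- move=> t; rewrite in01 => /andP[t0 t1] /=; rewrite /path_cat.
  case: (leP t 2^-1) => t12.
    rewrite /phi min_l; last by lra.
    by rewrite clampE // in01; lra.
  by rewrite /phi min_r; [rewrite clamp_ge1 // loop1|lra].
- by move=> t t01; rewrite lcE.
Qed.

Lemma loop_cst_cat f : homotopic (loop_cat loop_cst f) f.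
Proof.
pose phi (t : R) := Num.max (2 * t - 1) 0.
apply: (@homotopic_reparam f _ _ phi id) => //.
- by rewrite /phi; solve_cont.
- exact: cont_id.
- by rewrite /phi mulr0 add0r max_r //; lra.
- by rewrite /phi max_l; lra.
- move=> t; rewrite in01 => /andP[t0 t1] /=; rewrite /path_cat.
  case: (leP t 2^-1) => t12.
    by rewrite /phi max_r; [rewrite clamp_le0 // loop0|lra].
  rewrite /phi max_l; last by lra.
  by rewrite clampE // in01; lra.
- by move=> t t01; rewrite lcE.
Qed.

Lemma loop_cat_rev f : homotopic (loop_cat f (loop_rev f)) loop_cst.
Proof.
pose phi (t : R) := Num.min (2 * t) (2 - 2 * t).
apply: (@homotopic_reparam f _ _ phi (cst 0)) => //.
- by rewrite /phi; solve_cont.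
- exact: cont_cst.
- by rewrite /phi mulr0 subr0 min_l.
- by rewrite /phi /= min_r; lra.
- move=> t; rewrite in01 => /andP[t0 t1] /=; rewrite /path_cat /path_rev.
  case: (leP t 2^-1) => t12.
    rewrite /phi min_l; last by lra.
    by rewrite clampE // in01; lra.
  rewrite /phi min_r; last by lra.
  rewrite clampE; last by rewrite in01; lra.
  by congr (f _); lra.
- by move=> t t01; rewrite /= clamp_le0 // loop0.
Qed.

Lemma loop_rev_cat f : homotopic (loop_cat (loop_rev f) f) loop_cst.
Proof.
apply: homotopic_trans (loop_cat_rev (loop_rev f)).
apply: loop_cat_homotopic; first exact: homotopic_refl.
apply: homotopic_eq => t _; rewrite /= /path_rev.
by congr (f _); lra.
Qed.

End homotopy.

Section fundamental_group.
Context {R : realType} {T : topologicalType} (x : T).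

Definition homotopicb : rel (loop R x) := fun f g => `[< homotopic f g >].

Lemma homotopicb_equiv : equiv_class_of homotopicb.
Proof.
split.
- by move=> f; apply/asboolP; exact: homotopic_refl.
- by move=> f g; apply/asboolP/asboolP; exact: homotopic_sym.
- move=> g f h /asboolP fg /asboolP gh; apply/asboolP.
  exact: homotopic_trans fg gh.
Qed.

Canonical homotopicb_equiv_rel := EquivRelPack homotopicb_equiv.

Definition pi1 := {eq_quot homotopicb}.

HB.instance Definition _ := Choice.on pi1.
HB.instance Definition _ := Quotient.on pi1.

Definition loop_class (f : loop R x) : pi1 := \pi_pi1 f.

Lemma loop_classP f g : loop_class f = loop_class g <-> homotopic f g.
Proof.
split=> [/eqmodP /asboolP //|fg].
by apply/eqmodP/asboolP.
Qed.

Lemma loop_class_surj (u : pi1) : exists f, u = loop_class f.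
Proof. by exists (repr u); rewrite /loop_class reprK. Qed.

Definition pi1_mul (u v : pi1) := loop_class (loop_cat (repr u) (repr v)).
Definition pi1_inv (u : pi1) := loop_class (loop_rev (repr u)).
Definition pi1_one := loop_class loop_cst.

Let reprP (f : loop R x) : homotopic (repr (loop_class f)) f.
Proof. by apply/loop_classP; rewrite /loop_class reprK. Qed.

Lemma pi1_mulE f g :
  pi1_mul (loop_class f) (loop_class g) = loop_class (loop_cat f g).
Proof. by apply/loop_classP/loop_cat_homotopic; exact: reprP. Qed.

Lemma pi1_invE f : pi1_inv (loop_class f) = loop_class (loop_rev f).
Proof. by apply/loop_classP/loop_rev_homotopic; exact: reprP. Qed.

Let pi1_mulA : associative pi1_mul.
Proof.
move=> u v w; have [f ->] := loop_class_surj u.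
have [g ->] := loop_class_surj v; have [h ->] := loop_class_surj w.
by rewrite !pi1_mulE; apply/loop_classP/loop_catA.
Qed.

Let pi1_mul1 : left_id pi1_one pi1_mul.
Proof.
move=> u; have [f ->] := loop_class_surj u.
by rewrite !pi1_mulE; apply/loop_classP/loop_cst_cat.
Qed.

Let pi1_mulr1 : right_id pi1_one pi1_mul.
Proof.
move=> u; have [f ->] := loop_class_surj u.
by rewrite !pi1_mulE; apply/loop_classP/loop_cat_cst.
Qed.

Let pi1_mulV : left_inverse pi1_one pi1_inv pi1_mul.
Proof.
move=> u; have [f ->] := loop_class_surj u.
by rewrite pi1_invE !pi1_mulE; apply/loop_classP/loop_rev_cat.
Qed.

Let pi1_mulrV : right_inverse pi1_one pi1_inv pi1_mul.
Proof.
move=> u; have [f ->] := loop_class_surj u.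
by rewrite pi1_invE !pi1_mulE; apply/loop_classP/loop_cat_rev.
Qed.

HB.instance Definition _ :=
  isGroup.Build pi1 pi1_mulA pi1_mul1 pi1_mulr1 pi1_mulV pi1_mulrV.

Lemma loop_classM f g :
  (loop_class f * loop_class g)%g = loop_class (loop_cat f g).
Proof. exact: pi1_mulE. Qed.

End fundamental_group.

Arguments pi1 R {T} x.

Record pointed_map (T U : topologicalType) (x : T) (y : U) := PointedMap {
  pmap_fun :> T -> U;
  pmap_cont : continuous pmap_fun;
  pmap_base : pmap_fun x = y
}.

Section induced_map.
Context {R : realType} {T U : topologicalType} {x : T} {y : U}.
Variable q : pointed_map x y.

Program Definition loop_map (f : loop R x) : loop R y :=
  @Loop R U y (q \o f) _ _ _.
Next Obligation.
move=> f; apply: (within_continuous_eq (f := q \o (f \o clamp))).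
  by move=> t t01; rewrite /= clampE.
move=> t; apply: continuous_comp; first exact: lc_cont.
exact: pmap_cont.
Qed.
Next Obligation. by move=> f; rewrite /= loop0 pmap_base. Qed.
Next Obligation. by move=> f; rewrite /= loop1 pmap_base. Qed.

Lemma loop_map_homotopic f g :
  homotopic f g -> homotopic (loop_map f) (loop_map g).
Proof.
move=> /homotopic_global[H [cH _ Hf Hg Hx]].
apply: (homotopic_ext (H := q \o H)).
- by move=> p; apply: continuous_comp; [exact: cH|exact: pmap_cont].
- by move=> t t01 /=; rewrite Hf.
- by move=> t t01 /=; rewrite Hg.
- by move=> s _ /=; rewrite (Hx s).1 (Hx s).2 pmap_base.
Qed.

Definition pi1_map (u : pi1 R x) : pi1 R y := loop_class (loop_map (repr u)).

Lemma pi1_mapE f : pi1_map (loop_class f) = loop_class (loop_map f).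
Proof.
by apply/loop_classP/loop_map_homotopic/loop_classP; rewrite /loop_class reprK.
Qed.

Let pi1_mapM : {morph pi1_map : u v / (u * v)%g}.
Proof.
move=> u v; have [f ->] := loop_class_surj u; have [g ->] := loop_class_surj v.
rewrite loop_classM !pi1_mapE loop_classM; apply/loop_classP/homotopic_eq.
by move=> t _; rewrite /= /path_cat; case: ifP.
Qed.

HB.instance Definition _ := isMultiplicative.Build _ _ pi1_map pi1_mapM.

End induced_map.

(* The letter (i, false) stands for gamma_i and (i, true) for its inverse. *)
Definition word (n : nat) := seq ('I_n * bool).

Definition relator (n : nat) : word n := [seq (i, false) | i <- enum 'I_n].

Inductive word_eqv (n : nat) : word n -> word n -> Prop :=
| word_refl w : word_eqv w w
| word_sym w w' : word_eqv w w' -> word_eqv w' w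
| word_trans w w' w'' : word_eqv w w' -> word_eqv w' w'' -> word_eqv w w''
| word_cancel u v i b : word_eqv (u ++ [:: (i, b); (i, ~~ b)] ++ v) (u ++ v)
| word_relator u v : word_eqv (u ++ relator n ++ v) (u ++ v).

Section Gamma.
Variable n : nat.
Implicit Types u v w : word n.

Definition word_eqvb : rel (word n) := fun u v => `[< word_eqv u v >].

Lemma word_eqvb_equiv : equiv_class_of word_eqvb.
Proof.
split.
- by move=> w; apply/asboolP; exact: word_refl.
- by move=> u v; apply/asboolP/asboolP; exact: word_sym.
- by move=> v u w /asboolP uv /asboolP vw; apply/asboolP; exact: word_trans uv vw.
Qed.

Canonical word_eqvb_equiv_rel := EquivRelPack word_eqvb_equiv.

Definition Gamma := {eq_quot word_eqvb}.

HB.instance Definition _ := Choice.on Gamma.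
HB.instance Definition _ := Quotient.on Gamma.

Definition word_class w : Gamma := \pi_Gamma w.

Definition gamma (i : 'I_n) : Gamma := word_class [:: (i, false)].

Lemma word_classP u v : word_class u = word_class v <-> word_eqv u v.
Proof. by split=> [/eqmodP /asboolP //|uv]; apply/eqmodP/asboolP. Qed.

Lemma word_class_surj (g : Gamma) : exists w, g = word_class w.
Proof. by exists (repr g); rewrite /word_class reprK. Qed.

Lemma word_eqv_catl w u v : word_eqv u v -> word_eqv (w ++ u) (w ++ v).
Proof.
elim=> {u v} [u|u v _|u v u' _ + _|u v i b|u v].
- exact: word_refl.
- exact: word_sym.
- exact: word_trans.
- by rewrite !(catA w); exact: word_cancel.
- by rewrite !(catA w); exact: word_relator.
Qed.

Lemma word_eqv_catr w u v : word_eqv u v -> word_eqv (u ++ w) (v ++ w).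
Proof.
elim=> {u v} [u|u v _|u v u' _ + _|u v i b|u v].
- exact: word_refl.
- exact: word_sym.
- exact: word_trans.
- by rewrite -!catA; exact: word_cancel.
- by rewrite -!catA; exact: word_relator.
Qed.

Definition word_inv w : word n := rev [seq (p.1, ~~ p.2) | p <- w].

Lemma word_invK : involutive word_inv.
Proof.
move=> w; rewrite /word_inv map_rev revK -map_comp -[RHS]map_id.
by apply: eq_map => -[i b] /=; rewrite negbK.
Qed.

Lemma word_invr w : word_eqv (w ++ word_inv w) [::].
Proof.
elim: w => [|[i b] w IH]; first exact: word_refl.
have -> : ((i, b) :: w) ++ word_inv ((i, b) :: w) =
    [:: (i, b)] ++ (w ++ word_inv w) ++ [:: (i, ~~ b)].
  by rewrite /word_inv /= rev_cons -cats1 catA.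
apply: word_trans (word_eqv_catl _ (word_eqv_catr _ IH)) _.
exact: (word_cancel [::] [::]).
Qed.

Definition Gamma_mul (g h : Gamma) := word_class (repr g ++ repr h).
Definition Gamma_inv (g : Gamma) := word_class (word_inv (repr g)).

Let reprP w : word_eqv (repr (word_class w)) w.
Proof. by apply/word_classP; rewrite /word_class reprK. Qed.

Lemma Gamma_mulE u v :
  Gamma_mul (word_class u) (word_class v) = word_class (u ++ v).
Proof.
apply/word_classP; apply: word_trans (word_eqv_catr _ (reprP u)) _.
exact: word_eqv_catl (reprP v).
Qed.

Let Gamma_mulA : associative Gamma_mul.
Proof.
move=> g h k; have [u ->] := word_class_surj g.
have [v ->] := word_class_surj h; have [w ->] := word_class_surj k.
by rewrite !Gamma_mulE catA.
Qed.

Let Gamma_mul1 : left_id (word_class [::]) Gamma_mul.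
Proof. by move=> g; have [u ->] := word_class_surj g; rewrite Gamma_mulE. Qed.

Let Gamma_mulr1 : right_id (word_class [::]) Gamma_mul.
Proof.
by move=> g; have [u ->] := word_class_surj g; rewrite Gamma_mulE cats0.
Qed.

Let Gamma_mulV : left_inverse (word_class [::]) Gamma_inv Gamma_mul.
Proof.
move=> g; rewrite -{2}[g]reprK Gamma_mulE; apply/word_classP.
by have := word_invr (word_inv (repr g)); rewrite word_invK.
Qed.

Let Gamma_mulrV : right_inverse (word_class [::]) Gamma_inv Gamma_mul.
Proof.
move=> g; rewrite -{1}[g]reprK Gamma_mulE; apply/word_classP.
exact: word_invr.
Qed.

HB.instance Definition _ := isGroup.Build Gamma
  Gamma_mulA Gamma_mul1 Gamma_mulr1 Gamma_mulV Gamma_mulrV.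

Lemma word_classM u v :
  (word_class u * word_class v)%g = word_class (u ++ v).
Proof. exact: Gamma_mulE. Qed.

Lemma gamma_relation : (\prod_(i < n) gamma i)%g = 1%g.
Proof.
transitivity (word_class (relator n)); last first.
  apply/word_classP.
  by have := @word_relator n [::] [::]; rewrite cats0.
have -> : relator n = [seq (i, false) | i <- index_enum 'I_n].
  by rewrite /relator enumT [index_enum _]unlock.
elim: (index_enum _) => [|i s IH]; first by rewrite big_nil.
by rewrite big_cons IH word_classM.
Qed.

End Gamma.

Definition n_datum (n : nat) (gT : finGroupType)
    (theta : {multiplicative Gamma n -> gT}) : Prop :=
  (forall g : gT, exists w, theta w = g) /\ (forall i, theta (gamma i) <> 1%g).

Section induced_by_basis.
Context {G : groupType} {n : nat}.

Definition word_eval (B : 'I_n -> G) (w : word n) : G :=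
  (\prod_(p <- w) if p.2 then (B p.1)^-1 else B p.1)%g.

(* The graph of the morphism chi from Gamma_n to G determined by
   chi(gamma_i) = B i. *)
Definition chi_graph (B : 'I_n -> G) (g : Gamma n) (u : G) : Prop :=
  exists2 w, g = word_class w & u = word_eval B w.

Lemma chi_graphP (chi : {multiplicative Gamma n -> G}) (g : Gamma n) (u : G) :
  chi_graph (chi \o @gamma n) g u <-> u = chi g.
Proof.
have chi1 : chi 1%g = 1%g by apply: (@mulgI _ (chi 1%g)); rewrite -gmulfM !mulg1.
have chiV h : chi (h^-1)%g = ((chi h)^-1)%g.
  by apply: (@mulgI _ (chi h)); rewrite -gmulfM !mulgV.
have gammaV i : (gamma i)^-1%g = word_class [:: (i, true)].
  apply: (@mulgI _ (gamma i)); rewrite mulgV word_classM; apply/word_classP.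
  exact/word_sym/(word_cancel [::] [::]).
have chiE w : word_eval (chi \o @gamma n) w = chi (word_class w).
  rewrite /word_eval; elim: w => [|[i b] w IH]; first by rewrite big_nil chi1.
  rewrite big_cons IH -cat1s -word_classM gmulfM; congr mulg.
  by case: b => //=; rewrite -chiV gammaV.
split=> [[w -> ->]|->]; first exact: chiE.
by have [w ->] := word_class_surj g; exists w.
Qed.

End induced_by_basis.

Section subgroups.
Context {G : groupType}.

Definition is_subgroup (H : set G) : Prop :=
  [/\ H 1%g, forall u v, H u -> H v -> H (u * v)%g &
      forall u, H u -> H (u^-1)%g].

Definition finite_index (H : set G) : Prop :=
  finite_set [set [set (g * h)%g | h in H] | g in [set: G]].

End subgroups.

(* [Some z] is the point z of the complex plane, [None] is infinity. *)
Definition P1 (R : realType) := one_point_compactification (R[i]^o).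

HB.instance Definition _ (R : realType) := PointedTopological.on (P1 R).

Section configurations.
Context {R : realType} {n : nat}.
Implicit Types X : {ptws 'I_n -> P1 R}.

(* The points x_1, ..., x_n are X 0, ..., X (n - 1). *)
Definition M0 : set {ptws 'I_n -> P1 R} :=
  [set X : {ptws 'I_n -> P1 R} | [/\ injective X,
    forall i : 'I_n, (i.+3 = n)%N -> X i = Some 0,
    forall i : 'I_n, (i.+2 = n)%N -> X i = Some 1 &
    forall i : 'I_n, (i.+1 = n)%N -> X i = None]].

Definition P1_minus X : set (P1 R) := [set z | forall i, z <> X i].

Definition M0succ : set (P1 R * {ptws 'I_n -> P1 R}) :=
  [set y | M0 y.2 /\ P1_minus y.2 y.1].

End configurations.

Arguments M0 R n : clear implicits.
Arguments M0succ R n : clear implicits.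

Definition subset_elt (T : Type) (A : set T) (a : T) (Aa : A a) : A :=
  exist _ a (mem_set Aa).

Section bundle.
Context {R : realType} {n : nat}.

Lemma M0succP (x : M0succ R n) :
  M0 R n (val x).2 /\ P1_minus (val x).2 (val x).1.
Proof. by case: x => y yM; exact: set_mem yM. Qed.

Definition forget (x : M0succ R n) : M0 R n := subset_elt (M0succP x).1.

Definition moving_point (x : M0succ R n) : P1_minus (val x).2 :=
  subset_elt (M0succP x).2.

Definition fibre_incl_fun (x : M0succ R n) (z : P1_minus (val x).2) :
    M0succ R n :=
  subset_elt (conj (M0succP x).1 (set_mem (valP z))
    : M0succ R n (val z, (val x).2)).

Lemma set_type_continuous (T U : topologicalType) (A : set U) (f : T -> A) :
  continuous (fun t => val (f t)) -> continuous f.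
Proof. exact: continuous_comp_initial. Qed.

Lemma val_continuous (T : topologicalType) (A : set T) :
  continuous (fun a : A => val a).
Proof. exact: initial_continuous. Qed.

Lemma forget_continuous : continuous forget.
Proof.
apply: set_type_continuous.
exact: cont_comp (@val_continuous _ _) (@cont_snd _ _).
Qed.

Lemma fibre_incl_continuous (x : M0succ R n) : continuous (@fibre_incl_fun x).
Proof.
apply: set_type_continuous.
exact: cont_pair (@val_continuous _ _) (@cont_cst _ _ _).
Qed.

Lemma fibre_incl_base (x : M0succ R n) :
  fibre_incl_fun (moving_point x) = x.
Proof. by apply: val_inj => /=; case: (val x). Qed.

Definition bundle_proj (x : M0succ R n) : pointed_map x (forget x) :=
  PointedMap forget_continuous erefl.

Definition fibre_incl (x : M0succ R n) : pointed_map (moving_point x) x :=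
  PointedMap (@fibre_incl_continuous x) (fibre_incl_base x).

End bundle.

Section geometric_basis.
Context {R : realType}.

(* The inverse of the standard complex chart of the projective line centred at
   c, namely z - a for c = a and 1 / z for c = infinity. *)
Definition chart_inv (c : P1 R) (w : R[i]) : P1 R :=
  if c is Some a then Some (a + w) else if w == 0 then None else Some w^-1.

Definition cdisc (c : P1 R) (r : R) : set (P1 R) :=
  [set chart_inv c w | w in [set w | `|w| <= r%:C%C]].

Definition cexp (t : R) : R[i] := (cos t +i* sin t)%C.

Definition smooth (h : R -> R[i]) : Prop :=
  forall k t, derivable (derive1n k (fun s => complex.Re (h s))) t 1 /\
              derivable (derive1n k (fun s => complex.Im (h s))) t 1.

Definition derivC (h : R -> R[i]) (t : R) : R[i] :=
  (derive1 (fun s => complex.Re (h s)) t +i*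
   derive1 (fun s => complex.Im (h s)) t)%C.

(* The curve c : [0, 1] -> P^1 is smooth at t, in the sense that it locally
   extends to a smooth curve, and its velocity there is v, read in the chart
   centred at c t. *)
Definition has_velocity (c : R -> P1 R) (t : R) (v : R[i]) : Prop :=
  exists h : R -> R[i],
    [/\ smooth h,
        \forall s \near t, s \in `[0, 1] -> c s = chart_inv (c t) (h s) &
        derivC h t = v].

Definition smooth_embedded_arc (c : R -> P1 R) : Prop :=
  {in `[0, 1] &, injective c} /\
  forall t : R, t \in `[0, 1] -> exists2 v, v != 0 & has_velocity c t v.

(* Tangent vectors in distinct directions, met in this order when turning
   counterclockwise by less than one full turn. *)
Definition counterclockwise (n : nat) (v : 'I_n -> R[i]) : Prop :=
  exists (rho phi : 'I_n -> R),
    [/\ forall i, 0 < rho i /\ v i = (rho i)%:C%C * cexp (phi i),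
        forall i j : 'I_n, (i < j)%N -> phi i < phi j &
        forall i j, phi j < phi i + 2 * pi].

(* The path running along c up to the time tau, then once counterclockwise
   around the circle centred at e through the point of coordinate w in the
   chart at e, and back along c. *)
Definition lasso (c : R -> P1 R) (tau : R) (e : P1 R) (w : R[i]) : R -> P1 R :=
  let stem t := c (tau * t) in
  let circle t := chart_inv e (w * cexp (2 * pi * t)) in
  path_cat (path_cat stem circle) (path_rev stem).

Section basis.
Context {n : nat} (X : {ptws 'I_n -> P1 R}) (x0 : P1_minus X).
Variables (s : {perm 'I_n}) (c : 'I_n -> R -> P1 R).

Definition arc_system : Prop :=
  [/\ forall i,
        [/\ smooth_embedded_arc (c i), c i 0 = val x0 & c i 1 = X (s i)],
      forall i j t u, i != j -> t \in `[0, 1] -> u \in `[0, 1] ->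
        c i t = c j u -> c i t = val x0 &
      exists2 v : 'I_n -> R[i],
        counterclockwise v & forall i, has_velocity (c i) 0 (v i)].

(* Disjoint closed discs of radii r i around the end points, small with respect
   to the arcs: arc i meets the i-th disc exactly during [tau i, 1], entering it
   at the boundary point of coordinate w i, and the other arcs avoid it. *)
Definition small_discs (r tau : 'I_n -> R) (w : 'I_n -> R[i]) : Prop :=
  [/\ forall i, 0 < r i /\ 0 < tau i < 1,
      forall i, `|w i| = (r i)%:C%C /\
        c i (tau i) = chart_inv (X (s i)) (w i),
      forall i t, t \in `[0, 1] ->
        cdisc (X (s i)) (r i) (c i t) <-> tau i <= t,
      forall i j, i != j -> forall t, t \in `[0, 1] ->
        ~ cdisc (X (s i)) (r i) (c j t) &
      forall i j, i != j ->
        cdisc (X (s i)) (r i) `&` cdisc (X (s j)) (r j) = set0].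

End basis.

Definition geometric_basis (n : nat) (X : {ptws 'I_n -> P1 R})
    (x0 : P1_minus X) (B : 'I_n -> pi1 R x0) : Prop :=
  exists (s : {perm 'I_n}) (c : 'I_n -> R -> P1 R)
      (r tau : 'I_n -> R) (w : 'I_n -> R[i]),
  [/\ arc_system x0 s c, small_discs X s c r tau w &
      forall i, exists2 l : loop R x0, B i = loop_class l &
        forall t, t \in `[0, 1] ->
          val (l t) = lasso (c i) (tau i) (X (s i)) (w i) t].

End geometric_basis.

Section data.
Context {R : realType} {n : nat} {gT : finGroupType}.
Variables (x : M0succ R n) (B : 'I_n -> pi1 R (moving_point x)).
Variable theta : {multiplicative Gamma n -> gT}.

(* The values of [ext_mor] outside K_a = p_*^-1(H_a) are irrelevant. The last
   field is the equality f_a o i_* = theta o chi^-1. It is stated through the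
   graph of chi, so that the classical fact that chi is a well-defined
   isomorphism is not built into the definition; given this fact, it is
   literally that equality, by [ext_compatP]. *)
Record extension := Extension {
  ext_group : set (pi1 R (forget x));
  ext_subgroup : is_subgroup ext_group;
  ext_index : finite_index ext_group;
  ext_mor : pi1 R x -> gT;
  ext_morM : {in pi1_map (bundle_proj x) @^-1` ext_group &,
                {morph ext_mor : u v / (u * v)%g}};
  ext_compat : forall (g : Gamma n) (u : pi1 R (moving_point x)),
    chi_graph B g u -> ext_mor (pi1_map (fibre_incl x) u) = theta g
}.

Lemma ext_compatP (chi : {multiplicative Gamma n -> pi1 R (moving_point x)})
    (chiV : pi1 R (moving_point x) -> Gamma n) (f : pi1 R x -> gT) :
  (forall i, chi (gamma i) = B i) -> cancel chi chiV -> cancel chiV chi ->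
  (forall (g : Gamma n) (u : pi1 R (moving_point x)),
     chi_graph B g u -> f (pi1_map (fibre_incl x) u) = theta g) <->
  f \o pi1_map (fibre_incl x) =1 theta \o chiV.
Proof.
move=> chiB chiK chiVK.
have -> : B = chi \o @gamma n by apply/funext => i; rewrite /= chiB.
split=> [H u|H g u /chi_graphP ->]; last first.
  by have /= -> := H (chi g); rewrite chiK.
by apply: H; apply/chi_graphP; rewrite chiVK.
Qed.

End data.

(* Main.v *)
Require Import Defs.
From HB Require Import structures.
From mathcomp Require Import all_boot all_order all_algebra all_fingroup cyclic.
From mathcomp Require Import generic_quotient complex ring lra.
From mathcomp Require Import all_classical all_reals all_analysis.

(* A loop in M_{0,n+1} moves n finite points of the complex plane without
   collision: x_0 and x_j for j < n. Let w_j be the winding number of x_0 - x_j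
   around 0 along it. As G is abelian, sending a loop to the product over j < n
   of theta(gamma_i)^(w_j), where i is the index of the generator going around
   x_j, is a morphism f defined on the whole of K_x. The generator going around
   x_j with j < n has w_j = 1 and its other winding numbers vanish. The one
   going around infinity has all its winding numbers equal to -1, and f maps it
   to the right value because of the relation gamma_1 ... gamma_n = 1. *)

Set Implicit Arguments.
Unset Strict Implicit.
Unset Printing Implicit Defensive.

Import Order.TTheory GRing.Theory Num.Theory.
Import numFieldNormedType.Exports.

Local Open Scope classical_set_scope.
Local Open Scope ring_scope.

Lemma in_itv01 (R : realType) (t : R) : (t \in `[0, 1]) = (0 <= t <= 1).
Proof. by rewrite in_itv. Qed.

(** * Angle swept around 0 by a path in the plane *)

Section swept_angle.
Context {R : realType}.
Implicit Types (f g : R -> R[i]) (a b : R).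

Lemma cexpD a b : cexp (a + b) = cexp a * cexp b.
Proof.
apply/eqP; rewrite eq_complex /= cosD sinD; apply/andP; split; apply/eqP; ring.
Qed.

Lemma cexp0 : cexp 0 = 1 :> R[i].
Proof. by rewrite /cexp cos0 sin0. Qed.

Lemma cexpNK a : cexp (- a) * cexp a = 1.
Proof. by rewrite -cexpD addNr cexp0. Qed.

Lemma cexp_neq0 a : cexp a != 0.
Proof.
by apply/eqP => a0; move/eqP: (cexpNK a); rewrite a0 mulr0 eq_sym oner_eq0.
Qed.

Lemma cexpN a : cexp (- a) = (cexp a)^-1.
Proof. by rewrite -[RHS]mul1r -(cexpNK a) mulfK // cexp_neq0. Qed.

(* f : [0, 1] -> C^* turns by the angle a around 0. The angle theta is measured
   from f 0, so that no argument of f 0 has to be chosen. *)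
Definition swept f a : Prop :=
  exists theta : R -> R, [/\ continuous theta, theta 0 = 0, theta 1 = a &
    forall t, t \in `[0, 1] ->
      exists2 r : R, 0 < r & f t = r%:C%C * cexp (theta t) * f 0].

Lemma eq_swept f g a :
  (forall t, t \in `[0, 1] -> f t = g t) -> swept f a -> swept g a.
Proof.
move=> fg [th [cth th0 th1 H]]; exists th; split=> // t t01.
have [r r0 e] := H t t01; exists r => //.
by rewrite -!fg // in_itv01 lexx ler01.
Qed.

Lemma swept_cst (z : R[i]) : swept (cst z) 0.
Proof.
exists (cst 0); split=> // [|t _]; first exact: cont_cst.
by exists 1; rewrite // cexp0 !mul1r.
Qed.

Lemma swept_circle (z : R[i]) a : swept (fun t => z * cexp (a * t)) a.
Proof.
exists (fun t => a * t); split=> [||| t _].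
- by apply: cont_mul; [exact: cont_cst|exact: cont_id].
- by rewrite mulr0.
- by rewrite mulr1.
- by exists 1; rewrite // mulr0 cexp0 mulr1 mul1r mulrC.
Qed.

(** Angles along the reversed path are measured from [f 1], which has angle [a] as seen from [f 0];
    hence the shift by [- a]. *)
Lemma swept_rev f a : swept f a -> swept (path_rev f) (- a).
Proof.
move=> [th [cth th0 th1 H]]; exists (fun t => th (1 - t) - a); split.
- apply: cont_add; last exact: cont_cst.
  apply: (cont_comp _ cth); apply: cont_add; first exact: cont_cst.
  by apply: cont_opp; exact: cont_id.
- by rewrite subr0 th1 subrr.
- by rewrite subrr th0 sub0r.
- move=> t t01; rewrite /path_rev subr0.
  have /H[r r0 ->] : 1 - t \in `[0, 1] by move: t01; rewrite !in_itv01; lra.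
  have /H[r1 r10 ->] : (1 : R) \in `[0, 1] by rewrite in_itv01 lexx ler01.
  exists (r / r1); first exact: divr_gt0.
  rewrite th1 [RHS](_ : _ = (r%:C * (r1^-1%:C * r1%:C)%C)%C *
    (cexp (th (1 - t) - a) * cexp a) * f 0); last by rewrite rmorphM /=; ring.
  by rewrite -cexpD subrK -rmorphM /= mulVf ?gt_eqF // mulr1.
Qed.

(** The second path starts at [f 1], so its angle function, measured from there, is raised by
    [a]. *)
Lemma swept_cat f g a b :
  f 1 = g 0 -> swept f a -> swept g b -> swept (path_cat f g) (a + b).
Proof.
move=> fg [th [cth th0 th1 H]] [ph [cph ph0 ph1 K]].
exists (fun t => if t <= 2^-1 then th (2 * t) else a + ph (2 * t - 1)); split.
- apply: (@continuous_paste _ _ _ id); first exact: cont_id.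
  + by apply: (cont_comp _ cth); apply: cont_mul;
      [exact: cont_cst|exact: cont_id].
  + apply: cont_add; first exact: cont_cst.
    apply: (cont_comp _ cph); apply: cont_add; last exact: cont_cst.
    by apply: cont_mul; [exact: cont_cst|exact: cont_id].
  + by move=> t ->; rewrite divff // subrr ph0 addr0.
- by rewrite invr_ge0 ler0n mulr0.
- rewrite ifF; last by apply/negbTE; rewrite -ltNge; lra.
  by rewrite (_ : 2 * 1 - 1 = 1) ?ph1 //; lra.
- move=> t; rewrite in_itv01 => t01; rewrite /path_cat.
  rewrite invr_ge0 ler0n mulr0; case: ifPn => [tle|].
    by apply: H; rewrite in_itv01; lra.
  rewrite -ltNge => tgt.
  have /K[r r0 ->] : 2 * t - 1 \in `[0, 1] by rewrite in_itv01; lra.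
  have /H[r1 r10] : (1 : R) \in `[0, 1] by rewrite in_itv01 lexx ler01.
  rewrite -fg => ->; exists (r * r1); first exact: mulr_gt0.
  by rewrite th1 cexpD rmorphM /=; ring.
Qed.

(** The imaginary part gives [sin a = 0] and the real part gives [0 < cos a], which rules out
    [cos a = -1]. *)
Lemma cexp_pos (r a : R) :
  0 < r -> r%:C%C * cexp a = 1 -> cos a = 1 /\ sin a = 0.
Proof.
move=> r0 /eqP; rewrite eq_complex /= !mul0r addr0 subr0.
move=> /andP[/eqP rc /eqP rs].
have s0 : sin a = 0.
  by move/eqP: rs; rewrite mulf_eq0 gt_eqF //= => /eqP.
split=> //; have c0 : 0 < cos a.
  by rewrite -(pmulr_rgt0 _ r0) rc ltr01.
by rewrite -[cos a]gtr0_norm // sin0cos1.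
Qed.

(** The difference [d] of two angle functions of [f] starts at 0 and keeps [cexp (d t)] a positive
    real. If [d 1] were positive, [d] would take a value in []0, pi[], where the sine does not
    vanish. *)
Lemma swept_le f a b : f 0 != 0 -> swept f a -> swept f b -> a <= b.
Proof.
move=> f0 [th [cth th0 th1 H]] [ph [cph ph0 ph1 K]].
rewrite leNgt; apply/negP => ba.
pose d := fun t => th t - ph t.
have cd : continuous d by apply: cont_add => //; exact: cont_opp.
(* The minimum makes [v] both a value between [d 0] and [d 1] and a point of []0, pi[]. *)
pose v := Num.min (d 1) (pi / 2).
have v0 : 0 < v by rewrite lt_min /d th1 ph1 subr_gt0 ba divr_gt0 ?pi_gt0.
have vpi : v < pi by rewrite gt_min; apply/orP; right; have := pi_gt0 R; lra.
have vd : v <= d 1 by rewrite ge_min lexx.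
have d0 : d 0 = 0 by rewrite /d th0 ph0 subrr.
have [||c c01 dc] := @IVT R d 0 1 v ler01.
- exact: continuous_subspaceT.
- rewrite d0 min_l ?max_r ?(ltW v0) //; first exact: le_trans (ltW v0) vd.
  exact: le_trans (ltW v0) vd.
have [r r0 e] := H c c01; have [r' r'0 e'] := K c c01.
have : (r / r')%:C%C * cexp (d c) = 1.
  apply: (mulIf f0); rewrite mul1r.
  have r'C : r'%:C%C != 0 by rewrite eq_complex /= gt_eqF.
  apply: (mulfI r'C); apply: (mulfI (cexp_neq0 (ph c))).
  transitivity (cexp (-ph c) * cexp (ph c) * (r%:C%C * cexp (th c) * f 0)).
    rewrite /d cexpD rmorphM /= fmorphV; field.
    exact: r'C.
  by rewrite cexpNK mul1r -e e'; ring.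
move/cexp_pos => [|_]; first exact: divr_gt0.
by apply/eqP; rewrite gt_eqF // dc sin_gt0_pi // v0.
Qed.

Lemma swept_uniq f a b : f 0 != 0 -> swept f a -> swept f b -> a = b.
Proof. by move=> f0 fa fb; apply/eqP; rewrite eq_le !(swept_le f0). Qed.

(** Closedness makes [cexp a] a positive real, so [cos a = 1]. Subtracting the multiple of [2 * pi]
    given by the floor leaves [y] in [[0, 2 * pi[] with [cos y = 1]. *)
Lemma swept_loop f a : f 0 != 0 -> f 1 = f 0 -> swept f a ->
  exists k : int, a = 2 * pi * k%:~R.
Proof.
move=> f0 f10 [th [cth th0 th1 H]].
have /H[r r0] : (1 : R) \in `[0, 1] by rewrite in_itv01 lexx ler01.
rewrite f10 th1 -{1}[f 0]mul1r => /(mulIf f0)/esym/(cexp_pos r0)[ca _].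
have p0 : 0 < 2 * pi :> R by rewrite mulr_gt0 ?pi_gt0.
pose k := Num.floor (a / (2 * pi)); exists k.
have/andP[lo hi] : k%:~R <= a / (2 * pi) < (k + 1)%:~R by exact: floor_itv.
rewrite intrD /= in hi.
rewrite ler_pdivlMr // in lo; rewrite ltr_pdivrMr // in hi.
pose y := a - 2 * pi * k%:~R.
have per (z : R) (m : int) : cos (z + 2 * pi * m%:~R) = cos z.
  case: m => m; rewrite ?NegzE; last rewrite mulrNz mulrN.
    by rewrite -[RHS](periodicn (@cosD2pi R) m) -[_ *+ m]mulr_natr;
      congr cos; ring.
  by rewrite -[LHS](periodicn (@cosD2pi R) m.+1) -[_ *+ m.+1]mulr_natr;
      congr cos; ring.
have cy : cos y = 1 by rewrite -(per _ k) subrK.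
(* Halving puts [y / 2] in [[0, pi[], where the sine vanishes only at 0, so that [y = 0]. *)
have : sin (y / 2) = 0.
  have := @cos2Dsin2 R (y / 2); have := @cos_mulr2n R (y / 2).
  have -> : y / 2 *+ 2 = y by rewrite -mulr_natr divfK.
  rewrite cy => h1 h2.
  by apply/eqP; rewrite -sqrf_eq0; apply/eqP; lra.
have [y0|y0] := ltP 0 y; last by move=> _; rewrite /y in y0; nra.
by move/eqP; rewrite gt_eqF // sin_gt0_pi //; rewrite /y in y0 *; nra.
Qed.

End swept_angle.

(** * Existence and homotopy invariance of the swept angle *)

Section homotopy_invariance.
Context {R : realType}.
Implicit Types (f g : R -> R[i]) (a b : R).

(** Continuity is asked of the two components, so that only real-valued functions have to be
    handled. *)
Definition ccontinuous (T : topologicalType) (q : T -> R[i]) : Prop :=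
  continuous (fun x => complex.Re (q x)) /\
  continuous (fun x => complex.Im (q x)).

Lemma ccont_comp (S T : topologicalType) (p : S -> T) (q : T -> R[i]) :
  continuous p -> ccontinuous q -> ccontinuous (fun x => q (p x)).
Proof.
by move=> cp [cr ci]; split; [apply: (cont_comp cp cr)|apply: (cont_comp cp ci)].
Qed.

Lemma ccont_cst (T : topologicalType) (z : R[i]) : ccontinuous (fun _ : T => z).
Proof. by split; exact: cont_cst. Qed.

Lemma ccont_add (T : topologicalType) (p q : T -> R[i]) :
  ccontinuous p -> ccontinuous q -> ccontinuous (fun x => p x + q x).
Proof.
move=> [pr pi] [qr qi]; split; under eq_fun do rewrite raddfD; exact: cont_add.
Qed.

Lemma ccont_opp (T : topologicalType) (p : T -> R[i]) :
  ccontinuous p -> ccontinuous (fun x => - p x).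
Proof.
move=> [pr pi]; split; under eq_fun do rewrite raddfN; exact: cont_opp.
Qed.

Lemma ReM (u v : R[i]) : complex.Re (u * v) =
  complex.Re u * complex.Re v - complex.Im u * complex.Im v.
Proof. by case: u v => [a b] [c d]. Qed.

Lemma ImM (u v : R[i]) : complex.Im (u * v) =
  complex.Re u * complex.Im v + complex.Im u * complex.Re v.
Proof. by case: u v => [a b] [c d]. Qed.

Lemma ccont_mul (T : topologicalType) (p q : T -> R[i]) :
  ccontinuous p -> ccontinuous q -> ccontinuous (fun x => p x * q x).
Proof.
move=> [pr pi] [qr qi]; split.
  under eq_fun do rewrite ReM; apply: cont_add; first exact: cont_mul.
  by apply: cont_opp; exact: cont_mul.
by under eq_fun do rewrite ImM; apply: cont_add; exact: cont_mul.
Qed.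

Lemma ccont_conj (T : topologicalType) (p : T -> R[i]) :
  ccontinuous p -> ccontinuous (fun x => (p x)^*%C).
Proof.
move=> [pr pi]; split.
  rewrite (_ : (fun x => _) = fun x => complex.Re (p x)) //.
  by apply/funext => x; case: (p x).
rewrite (_ : (fun x => _) = fun x => - complex.Im (p x)); last first.
  by apply/funext => x; case: (p x).
exact: cont_opp.
Qed.

Lemma mulJ_Re (z : R[i]) : z * z^*%C = (complex.Re (z * z^*%C))%:C%C.
Proof.
by case: z => x y; apply/eqP; rewrite eq_complex /= eqxx /=; apply/eqP; ring.
Qed.

Lemma mulJ_gt0 (z : R[i]) : z != 0 -> 0 < complex.Re (z * z^*%C).
Proof.
case: z => x y; rewrite eq_complex /= negb_and mulrN opprK -!expr2.
by case/orP => h; [apply: ltr_pwDl|apply: ltr_wpDl];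
  rewrite ?sqr_ge0 // exprn_even_gt0.
Qed.

Lemma polar_right (z : R[i]) : 0 < complex.Re z -> exists2 r : R, 0 < r &
  z = r%:C%C * cexp (atan (complex.Im z / complex.Re z)).
Proof.
case: z => x y /= x0; set t := y / x.
have t0 : 0 < 1 + t ^+ 2 by rewrite ltr_wpDr ?sqr_ge0.
have ct : 0 < cos (atan t) by rewrite cos_atan invr_gt0 sqrtr_gt0.
have st : sin (atan t) = t * cos (atan t).
  by rewrite -{2}[t]atanK /tan divfK // gt_eqF.
exists (x / cos (atan t)); first exact: divr_gt0.
have cn : cos (atan t) != 0 by rewrite gt_eqF.
apply/eqP; rewrite eq_complex /= !mul0r subr0 addr0 st divfK // eqxx /=.
by apply/eqP; rewrite /t; field; rewrite cn gt_eqF.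
Qed.

(* The principal argument, correct only in the half-plane Re z > 0. *)
Definition carg (z : R[i]) : R := atan (complex.Im z / complex.Re z).

(** The quotient of [f] by [g] is a positive multiple of [f] times the conjugate of [g], which stays
    in the right half-plane. There [carg] is continuous, and its variation is added to the angle of
    [g]. *)
Lemma swept_near f g a : ccontinuous f -> ccontinuous g ->
  (forall t, t \in `[0, 1] -> 0 < complex.Re (f t * (g t)^*%C)) ->
  swept g a -> swept f (a + (carg (f 1 * (g 1)^*%C) - carg (f 0 * (g 0)^*%C))).
Proof.
move=> cf cg fg [th [cth th0 th1 H]].
have [zr zi] := ccont_mul cf (ccont_conj cg).
have i0 : (0 : R) \in `[0, 1] by rewrite in_itv01 lexx ler01.
pose z t := f t * (g t)^*%C.
(* The half-plane condition holds on [[0, 1]] only, while the angle function must be continuous on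
   all of [R]: hence [clamp]. *)
exists (fun t => th t + (carg (z (clamp t)) - carg (z 0))); split.
- apply: cont_add => //; apply: cont_add; last exact: cont_cst.
  apply: (cont_comp _ (@continuous_atan R)); apply: cont_mul.
    exact: (cont_comp (@continuous_clamp R) zi).
  move=> t; apply: cvgV; first by rewrite gt_eqF // fg // clamp_itv.
  exact: (cont_comp (@continuous_clamp R) zr).
- by rewrite clamp_le0 // th0 subrr addr0.
- by rewrite clamp_ge1 // th1.
- move=> t t01; rewrite clampE //.
  have [r r0 e] := H t t01.
  have [p p0 ep] := polar_right (fg t t01).
  have [q q0 eq] := polar_right (fg 0 i0).
  have nz s : s \in `[0, 1] -> exists2 n : R, 0 < n & g s * (g s)^*%C = n%:C%C.
    move=> /fg h; exists (complex.Re (g s * (g s)^*%C)); last exact: mulJ_Re.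
    by apply: mulJ_gt0; apply: contraTneq h => ->; rewrite conjc0 mulr0 ltxx.
  have [n n0 en] := nz t t01; have [m m0 em] := nz 0 i0.
  have nn : n%:C%C != 0 by rewrite eq_complex /= gt_eqF.
  have mn : m%:C%C != 0 by rewrite eq_complex /= gt_eqF.
  have qn : q%:C%C != 0 by rewrite eq_complex /= gt_eqF.
  exists (p * r * m / (n * q)).
    by rewrite divr_gt0 ?mulr_gt0.
  have ft : f t = p%:C%C * cexp (carg (z t)) * g t / n%:C%C.
    by rewrite -ep -(mulrA (f t)) [_^*%C * _]mulrC en mulfK.
  have f0 : f 0 = q%:C%C * cexp (carg (z 0)) * g 0 / m%:C%C.
    by rewrite -eq -(mulrA (f 0)) [_^*%C * _]mulrC em mulfK.
  rewrite ft e f0 !cexpD.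
  rewrite !(fmorphV, rmorphM) /=.
  transitivity (p%:C%C * cexp (carg (z t)) *
    (r%:C%C * cexp (th t) * g 0) / n%:C%C *
    (cexp (- carg (z 0)) * cexp (carg (z 0)))); first by rewrite cexpNK mulr1.
  by field; rewrite nn mn qn.
Qed.

Lemma swept_near_loop f g a : ccontinuous f -> ccontinuous g ->
  f 1 = f 0 -> g 1 = g 0 ->
  (forall t, t \in `[0, 1] -> 0 < complex.Re (f t * (g t)^*%C)) ->
  swept g a -> swept f a.
Proof.
move=> cf cg f1 g1 fg /(swept_near cf cg fg).
by rewrite f1 g1 subrr addr0.
Qed.

(* The set of s satisfying P is open and closed: since the segment is compact,
   H (s, t) stays in the half-plane centred at H (s', t) for all t when s is
   close to s'. *)
Lemma deformation_ind (H : R * R -> R[i]) (P : R -> Prop) :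
  ccontinuous H -> (forall p, H p != 0) ->
  (forall s s', (forall t, t \in `[0, 1] ->
     0 < complex.Re (H (s, t) * (H (s', t))^*%C)) -> P s' -> P s) ->
  P 0 -> P 1.
Proof.
move=> cH H0 PH P0.
have ReC (u v : R[i]) : complex.Re (u * v^*%C) = complex.Re (v * u^*%C).
  by case: u v => [a b] [c d] /=; ring.
have loc s0 : \forall s \near s0, P s <-> P s0.
  have : \forall s \near s0, `[0, 1] `<=`
      [set t | 0 < complex.Re (H (s, t) * (H (s0, t))^*%C)].
    have /compact_near_coveringP nc := @segment_compact R 0 1.
    apply: (nc _ (nbhs s0) (fun s t =>
      0 < complex.Re (H (s, t) * (H (s0, t))^*%C))) => t t01 /=.
    pose K (p : R * R) := complex.Re (H (p.2, p.1) * (H (s0, p.1))^*%C).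
    have cK : continuous K.
      have [+ _] :
          ccontinuous (fun p : R * R => H (p.2, p.1) * (H (s0, p.1))^*%C).
        apply: ccont_mul.
          by apply: (ccont_comp _ cH); apply: cont_pair;
            [exact: cont_snd|exact: cont_fst].
        apply: ccont_conj; apply: (ccont_comp _ cH).
        by apply: cont_pair; [exact: cont_cst|exact: cont_fst].
      by [].
    have K0 : 0 < K (t, s0) by exact: mulJ_gt0.
    have := cK (t, s0) [set x | 0 < x]; apply.
    exact: (open_nbhs_nbhs (conj (@open_gt R 0) K0)).
  apply: filterS => s hs; split; apply: PH => t t01; last exact: hs.
  by rewrite ReC; exact: hs.
have oP : open [set s | P s].
  by rewrite openE => s /= Ps; apply: filterS (loc s) => s' /= ->.
have cP : closed [set s | P s].
  rewrite -openC openE => s /= Ps; apply: filterS (loc s) => s' /= e /e.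
  exact: Ps.
have := @segment_connected R 0 1 (`[0, 1] `&` [set s | P s]).
case/(_ _ _ _)/seteqP => [|||_ h].
- by exists 0; split=> //=; rewrite in_itv01 lexx ler01.
- by exists [set s | P s].
- by exists [set s | P s].
- have [] // : (`[0, 1] `&` [set s | P s]) (1 : R).
  by apply: h; rewrite /= in_itv01 lexx ler01.
Qed.

(* Contract f to its starting point through t |-> f (s t). *)
Lemma swept_ex f : ccontinuous f -> (forall t, f t != 0) -> exists a, swept f a.
Proof.
move=> cf f0.
have cH : ccontinuous (fun p : R * R => f (p.1 * p.2)).
  by apply: (ccont_comp _ cf); apply: cont_mul;
    [exact: cont_fst|exact: cont_snd].
have cHs (s : R) : ccontinuous (fun t : R => f (s * t)).
  by apply: (ccont_comp _ cf); apply: cont_mul;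
    [exact: cont_cst|exact: cont_id].
have := @deformation_ind _ (fun s => exists a, swept (fun t => f (s * t)) a) cH.
case=> [p//|s s' ss' [a fa]||a fa].
- by eexists; apply: swept_near fa.
- by exists 0; apply: eq_swept (swept_cst (f 0)) => t _; rewrite mul0r.
- by exists a; apply: eq_swept fa => t _; rewrite mul1r.
Qed.

(** All intermediate paths are closed, so the correction term of [swept_near] vanishes and
    [deformation_ind] transports the same angle from 0 to 1. *)
Lemma swept_homotopy (H : R * R -> R[i]) a : ccontinuous H ->
  (forall p, H p != 0) -> (forall s, H (s, 1) = H (s, 0)) ->
  swept (fun t => H (0, t)) a -> swept (fun t => H (1, t)) a.
Proof.
move=> cH H0 Hl.
have cHs (s : R) : ccontinuous (fun t : R => H (s, t)).
  by apply: (ccont_comp _ cH); apply: cont_pair;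
    [exact: cont_cst|exact: cont_id].
apply: (@deformation_ind _ (fun s => swept (fun t => H (s, t)) a) cH H0).
move=> s s' ss'; exact: swept_near_loop.
Qed.

End homotopy_invariance.

(** * The winding number as a morphism on the fundamental group *)

Section winding.
Context {R : realType} {T : topologicalType} {x : T} {q : T -> R[i]}.
Implicit Types l : loop R x.

(** For [q] continuous and nowhere zero exactly one [k] qualifies, so the default 0 is never
    taken. *)
Definition winding (u : pi1 R x) : int :=
  xget 0 [set k : int | swept (q \o repr u) (2 * pi * k%:~R)].

Hypotheses (cq : ccontinuous q) (q0 : forall y, q y != 0).

Lemma loop_swept l : exists k : int, swept (q \o l) (2 * pi * k%:~R).
Proof.
(* [swept_ex] asks for a path on all of [R], whereas [l] is controlled on [[0, 1]] only; it is
   clamped first. *)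
have [a la] := swept_ex (ccont_comp (@lc_cont _ _ _ l) cq)
  (fun t => q0 ((l \o clamp) t)).
have {}la : swept (q \o l) a by apply: eq_swept la => t t01 /=; rewrite clampE.
have l10 : (q \o l) 1 = (q \o l) 0 by rewrite /= loop0 loop1.
have [k ak] := swept_loop (q0 _) l10 la.
by exists k; rewrite -ak.
Qed.

Lemma homotopic_swept l l' a :
  homotopic l l' -> swept (q \o l) a -> swept (q \o l') a.
Proof.
move=> /homotopic_global[H [cH _ Hl Hl' Hx]] la.
apply: eq_swept (_ : swept (fun t => q (H (1, t))) a) => [t t01|].
  by rewrite Hl'.
apply: (@swept_homotopy _ (q \o H)) => [||s|].
- exact: (ccont_comp cH cq).
- by move=> p; exact: q0.
- by rewrite /= (Hx s).1 (Hx s).2.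
- by apply: eq_swept la => t t01; rewrite /= Hl.
Qed.

Lemma winding_swept l : swept (q \o l) (2 * pi * (winding (loop_class l))%:~R).
Proof.
apply: (@homotopic_swept (repr (loop_class l))).
  by apply/loop_classP; rewrite /loop_class reprK.
have [k lk] := loop_swept (repr (loop_class l)).
by rewrite /winding; case: xgetP => [m _ //|/(_ k)].
Qed.

Lemma windingE l (k : int) :
  swept (q \o l) (2 * pi * k%:~R) -> winding (loop_class l) = k.
Proof.
move=> /(swept_uniq (q0 _) (winding_swept l)) /mulfI h.
by apply/intr_inj/h; rewrite mulf_neq0 ?gt_eqF ?pi_gt0.
Qed.

Lemma windingM : {morph winding : u v / (u * v)%g >-> u + v}.
Proof.
move=> u v; have [l ->] := loop_class_surj u; have [m ->] := loop_class_surj v.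
rewrite loop_classM; apply: windingE; rewrite intrD mulrDr.
have e : (q \o l) 1 = (q \o m) 0 by rewrite /= loop0 loop1.
apply: eq_swept (swept_cat e (winding_swept l) (winding_swept m)) => t _.
by rewrite /= /path_cat; case: ifP.
Qed.

End winding.
Arguments winding {R T x} q u.

(** * The affine coordinate on the projective line *)

Section affine_coordinate.
Context {R : realType}.

(* The value of [affine] at infinity is irrelevant. *)
Definition affine (p : P1 R) : R[i] := odflt 0 p.

Lemma normc_ge_Im (z : R[i]) : `|complex.Im z|%:C%C <= `|z|.
Proof.
have := normc_ge_Re (z * 'i%C); rewrite ReiNIm normrN normrM.
rewrite (_ : `|'i%C| = 1 :> R[i]) ?mulr1 //.
by rewrite normc_def /= expr0n expr1n add0r sqrtr1.
Qed.

Let lipschitz_continuous (f : R[i]^o -> R) :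
  (forall u v, `|f u - f v|%:C%C <= `|u - v|) -> continuous f.
Proof.
move=> fL z; apply/(@cvgrPdist_lt _ R^o _ _ (nbhs_filter (z : R[i]^o))) => e e0.
have e0C : 0 < e%:C%C :> R[i] by rewrite ltcR.
by exists e%:C%C => //= w zw; rewrite -ltcR; exact: le_lt_trans (fL z w) zw.
Qed.

Lemma continuous_Re : continuous (@complex.Re R : R[i]^o -> R).
Proof.
by apply: lipschitz_continuous => u v; rewrite -raddfB; exact: normc_ge_Re.
Qed.

Lemma continuous_Im : continuous (@complex.Im R : R[i]^o -> R).
Proof.
by apply: lipschitz_continuous => u v; rewrite -raddfB; exact: normc_ge_Im.
Qed.

(** Neighbourhoods of a finite point in the one-point compactification are those of the plane, so
    the coordinate is continuous away from infinity. *)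
Lemma ccont_affine (T : topologicalType) (p : T -> P1 R) :
  continuous p -> (forall y, p y <> None) -> ccontinuous (affine \o p).
Proof.
move=> cp pN; split=> y.
  apply: (@continuous_comp _ _ _ p (fun z => complex.Re (affine z))).
    exact: cp.
  by case: (p y) (pN y) => // z _; exact: (@continuous_Re z).
apply: (@continuous_comp _ _ _ p (fun z => complex.Im (affine z))).
  exact: cp.
by case: (p y) (pN y) => // z _; exact: (@continuous_Im z).
Qed.

End affine_coordinate.

(** * Angles swept by circles and lassos *)

Section circles.
Context {R : realType}.
Implicit Types (f g : R -> R[i]) (a b w : R[i]).

Lemma ccont_circle w (k : R) : ccontinuous (fun t : R => w * cexp (k * t)).
Proof.
apply: ccont_mul; first exact: ccont_cst.
have ck : continuous (fun t : R => k * t).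
  by apply: cont_mul; [exact: cont_cst|exact: cont_id].
split; first exact: (cont_comp ck (@continuous_cos R)).
exact: (cont_comp ck (@continuous_sin R)).
Qed.

Lemma cexp2pi : cexp (2 * pi) = 1 :> R[i].
Proof. by rewrite /cexp mulr_natl cos2pi sin2pi. Qed.

Lemma normc_cexp (t : R) : `|cexp t| = 1 :> R[i].
Proof. by rewrite normc_def /= cos2Dsin2 sqrtr1. Qed.

Lemma Re_mul_conj_gt0 a b : `|a - b| < `|b| -> 0 < complex.Re (a * b^*%C).
Proof.
move=> ab; have b0 : 0 < `|b| by apply: le_lt_trans ab.
have : `|complex.Re ((a - b) * b^*%C)|%:C%C <
    (complex.Re (b * b^*%C))%:C%C :> R[i].
  apply: le_lt_trans (normc_ge_Re _) _; rewrite normrM normcJ.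
  by rewrite -mulJ_Re -sqr_normc expr2 ltr_pM2r.
rewrite ltcR ltr_norml => /andP[+ _]; rewrite -subr_gt0 opprK -raddfD /=.
by rewrite -mulrDl subrK.
Qed.

(** Dog-on-a-leash principle, as in Rouché's theorem: [f t] stays in the half-plane centred at
    [g t]. *)
Lemma swept_perturb f g (k : R) : ccontinuous f -> ccontinuous g ->
  f 1 = f 0 -> g 1 = g 0 -> (forall t, `|f t - g t| < `|g t|) ->
  swept g k -> swept f k.
Proof.
move=> cf cg f1 g1 fg; apply: swept_near_loop => // t _.
exact/Re_mul_conj_gt0/fg.
Qed.

(** The point [b] lies outside the circle, so the path is a small perturbation of the constant
    [a - b]. *)
Lemma swept_outside a b w : `|w| < `|a - b| ->
  swept (fun t => a + w * cexp (2 * pi * t) - b) 0.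
Proof.
move=> wab; apply: (@swept_perturb _ (cst (a - b))) => [||||t|].
- apply: ccont_add; last exact: ccont_cst.
  by apply: ccont_add; [exact: ccont_cst|exact: ccont_circle].
- exact: ccont_cst.
- by rewrite mulr1 mulr0 cexp0 cexp2pi.
- by [].
- have -> : a + w * cexp (2 * pi * t) - b - cst (a - b) t =
      w * cexp (2 * pi * t).
    by rewrite /=; ring.
  by rewrite normrM normc_cexp mulr1.
- exact: swept_cst.
Qed.

(** In the chart [1 / z] a counterclockwise circle becomes a clockwise one of radius [1 / |w|]. It
    encloses [b], and subtracting [b] is a small perturbation. *)
Lemma swept_around_infinity b w : w != 0 -> `|w| * `|b| < 1 ->
  swept (fun t => (w * cexp (2 * pi * t))^-1 - b) (- (2 * pi)).
Proof.
move=> w0 wb; apply: (@swept_perturb _ (fun t => w^-1 * cexp (- (2 * pi) * t)))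
  => [||||t|].
- rewrite (_ : (fun _ => _) = fun t => w^-1 * cexp (- (2 * pi) * t) + - b).
    by apply: ccont_add; [exact: ccont_circle|exact: ccont_cst].
  by apply/funext => t; rewrite invfM -cexpN mulNr.
- exact: ccont_circle.
- by rewrite mulr1 mulr0 cexp0 cexp2pi.
- by rewrite mulr1 mulr0 cexp0 cexpN cexp2pi invr1.
- rewrite mulNr cexpN -invfM addrC addKr normrN normfV normrM normc_cexp mulr1.
  by rewrite -[_^-1]mul1r ltr_pdivlMr ?normr_gt0 // mulrC.
- exact: swept_circle.
Qed.

(** The angle [a] of the stem cancels on the way back. *)
Lemma swept_lasso (A C : R -> R[i]) (a k : R) : A 1 = C 0 -> C 1 = C 0 ->
  swept A a -> swept C k -> swept (path_cat (path_cat A C) (path_rev A)) k.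
Proof.
move=> AC C10 hA hC.
have := swept_cat _ (swept_cat AC hA hC) (swept_rev hA).
rewrite addrAC subrr add0r; apply.
rewrite /path_cat /path_rev subr0 ifF; last by apply/negbTE; rewrite -ltNge; lra.
by rewrite (_ : 2 * 1 - 1 = 1) ?C10 //; lra.
Qed.

End circles.

(** * The functions [x_0 - x_j] on the total space *)

Section configuration_points.
Context {R : realType} {n : nat}.
Implicit Types (y : M0succ R n) (j last : 'I_n).

Definition difference j y : R[i] := affine (val y).1 - affine ((val y).2 j).

Lemma M0_finite (X : {ptws 'I_n -> P1 R}) last j : M0 R n X ->
  last.+1 = n -> j != last -> X j <> None.
Proof.
move=> [Xinj _ _ /(_ last)] + ln jl Xj => /(_ ln) Xl.
by move/eqP: jl; apply; apply: Xinj; rewrite Xj Xl.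
Qed.

Lemma moving_finite y last : last.+1 = n -> (val y).1 <> None.
Proof.
move=> ln; have [[_ _ _ /(_ _ ln) Xl] yX] := M0succP y.
by rewrite -Xl; exact: yX.
Qed.

Lemma difference_neq0 last j : last.+1 = n -> j != last ->
  forall y, difference j y != 0.
Proof.
move=> ln jl y; rewrite /difference subr_eq0; apply/eqP.
have [My /(_ j) yX] := M0succP y.
have := moving_finite (y := y) ln; have := M0_finite My ln jl.
move: yX; case: (val y) => -[a|//] X /=; case: (X j) => [b|//] ab _ _ /= e.
by apply: ab; rewrite e.
Qed.

Lemma ccont_difference last j : last.+1 = n -> j != last ->
  ccontinuous (difference j).
Proof.
move=> ln jl; apply: (@ccont_add _ _ (affine \o (fun y => (val y).1))
  (fun y => - affine ((val y).2 j))).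
  apply: ccont_affine => [|y]; last exact: moving_finite ln.
  exact: cont_comp (@val_continuous _ _) (@cont_fst _ _).
apply: (@ccont_opp _ _ (affine \o (fun y : M0succ R n => (val y).2 j))).
apply: ccont_affine => [|y]; last exact: M0_finite (M0succP y).1 ln jl.
have c2 := cont_comp (@val_continuous _ (M0succ R n)) (@cont_snd _ _).
exact: (cont_comp c2 (@proj_continuous 'I_n (fun=> P1 R) j)).
Qed.

End configuration_points.

(** * Winding numbers of the geometric basis *)

Section basis_winding.
Context {R : realType} {n : nat} (x : M0succ R n) (last : 'I_n).
Hypothesis ln : last.+1 = n.

Local Notation X := (val x).2.

Lemma cdisc_center (p : P1 R) (r : R) : 0 <= r -> cdisc p r p.
Proof.
move=> r0; exists 0; first by rewrite /= normr0 ler0c.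
by rewrite /chart_inv; case: p => [a|]; rewrite ?addr0 ?eqxx.
Qed.

Lemma winding_lasso (s : {perm 'I_n}) (c : 'I_n -> R -> P1 R)
    (r tau : 'I_n -> R) (w : 'I_n -> R[i]) (i j : 'I_n)
    (l : loop R (moving_point x)) :
  small_discs X s c r tau w ->
  (forall t, t \in `[0, 1] ->
    val (l t) = lasso (c i) (tau i) (X (s i)) (w i) t) ->
  j != last ->
  winding (difference j) (pi1_map (fibre_incl x) (loop_class l)) =
  if s i == j then 1 else if s i == last then -1 else 0.
Proof.
move=> [rtau wr _ _ dd] lE jl.
have cq := ccont_difference (R := R) ln jl.
have q0 := difference_neq0 (R := R) ln jl.
have [r0 _] := rtau i; have [wi cw] := wr i.
have w0 : w i != 0.
  by rewrite -normr_gt0 wi ltcR.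
rewrite pi1_mapE; apply: (windingE cq q0).
set m := loop_map _ l.
pose b := affine (X j).
pose A t := affine (c i (tau i * t)) - b.
pose C t := affine (chart_inv (X (s i)) (w i * cexp (2 * pi * t))) - b.
have mE t : t \in `[0, 1] ->
    difference j (m t) = path_cat (path_cat A C) (path_rev A) t.
  move=> t01; rewrite /difference /= lE // /lasso /path_cat /path_rev /A /C /b.
  by case: ifP => _ //; case: ifP.
(* The stem occupies the first quarter of the lasso, so [A t] is [difference j] at [m (t / 4)], a
   nowhere zero path. *)
have [a hA] : exists a, swept A a.
  have c4 : continuous (fun t : R => 4^-1 * t).
    by apply: cont_mul; [exact: cont_cst|exact: cont_id].
  have [a ha] := swept_ex (ccont_comp c4 (ccont_comp (@lc_cont _ _ _ m) cq))
    (fun t => q0 _).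
  exists a; apply: eq_swept ha => t; rewrite in_itv01 => t01 /=.
  rewrite clampE ?in_itv01; last by lra.
  rewrite mE ?in_itv01; last by lra.
  rewrite /path_cat ifT; last by lra.
  rewrite ifT; last by lra.
  by congr A; lra.
have AC : A 1 = C 0.
  by rewrite /A /C mulr1 mulr0 cexp0 mulr1 cw.
have C10 : C 1 = C 0.
  by rewrite /C mulr1 mulr0 cexp0 cexp2pi.
apply: (eq_swept (f := path_cat (path_cat A C) (path_rev A))).
  by move=> t t01; rewrite -mE.
apply: swept_lasso AC C10 hA _.
have [Mx _] := M0succP x; have [Xinj _ _ /(_ _ ln) Xl] := Mx.
have Xjn := M0_finite Mx ln jl.
(* [X j] is the centre of the disc of index [k], which is disjoint from the disc of index [i]. *)
have out : s i != j -> ~ cdisc (X (s i)) (r i) (X j).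
  move=> sij Xj; pose k := (s^-1)%g j.
  have sk : s k = j by rewrite /k permKV.
  have ik : i != k by apply: contraNneq sij => ->; rewrite sk.
  have := dd i k ik; rewrite -subset0 sk => /(_ (X j)); apply; split=> //.
  by apply: cdisc_center; have [/ltW] := rtau k.
have Xsb : X j = Some b by rewrite /b; case: (X j) Xjn.
case: eqP => [sij|/eqP sij].
  rewrite mulr1; apply: eq_swept (swept_circle (w i) (2 * pi)) => t _.
  by rewrite /C sij Xsb /= addrC addKr.
have {}out := out sij.
case: eqP => [sil|/eqP sil].
  rewrite mulrN1; apply: eq_swept (_ : swept (fun t =>
    (w i * cexp (2 * pi * t))^-1 - b) _) => [t _|].
    rewrite /C sil Xl /= ifF //; apply/negbTE.
    by rewrite mulf_neq0 // -normr_gt0 normc_cexp.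
  apply: swept_around_infinity => //.
  (* Otherwise [b^-1], the coordinate of [X j] at infinity, would have modulus at most [r i],
     putting [X j] in the disc. *)
  have [->|b0] := eqVneq b 0; first by rewrite normr0 mulr0.
  rewrite -ltr_pdivlMr ?normr_gt0 // mul1r -normfV real_ltNge ?normr_real //.
  apply/negP => bw; apply: out; rewrite sil Xl Xsb; exists b^-1.
    by rewrite /= -wi.
  by rewrite /chart_inv invr_eq0 (negbTE b0) invrK.
rewrite mulr0; have Xi := M0_finite Mx ln sil.
have Xsa : X (s i) = Some (affine (X (s i))) by case: (X (s i)) Xi.
apply: eq_swept (_ : swept (fun t =>
  affine (X (s i)) + w i * cexp (2 * pi * t) - b) _) => [t _|].
  by rewrite /C {2}Xsa.
apply: swept_outside; rewrite real_ltNge ?normr_real //; apply/negP => bw.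
apply: out; rewrite Xsa Xsb; exists (b - affine (X (s i))).
  by rewrite /= -wi distrC.
by rewrite /chart_inv addrC subrK.
Qed.

End basis_winding.

(** * Integer powers and products in a finite abelian group *)

Section group_powers.
Context {gT : finGroupType}.
Implicit Types (g h : gT).

(* Integer power, with the exponent reduced modulo the order of g. *)
Definition zexpg g (k : int) : gT := (g ^+ `|(k %% #[g]%g)%Z|%N)%g.

Lemma zexpgD g (k l : int) : zexpg g (k + l) = (zexpg g k * zexpg g l)%g.
Proof.
have og : #[g]%g%:Z != 0 by rewrite eqz_nat -lt0n order_gt0.
rewrite -expgD; apply/eqP; rewrite eq_expg_mod_order; apply/eqP.
apply: (can_inj absz_nat).
by rewrite -!modz_nat PoszD !gez0_abs ?modz_ge0 // modzDm modz_mod.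
Qed.

Lemma zexpg0 g : zexpg g 0 = 1%g.
Proof. by rewrite /zexpg mod0z. Qed.

Lemma zexpg1 g : zexpg g 1 = g.
Proof.
apply/eqP; rewrite -{2}[g]expg1 eq_expg_mod_order.
have -> : (1 %% #[g]%g)%Z = (1 %% #[g]%g)%N by rewrite modz_nat.
by rewrite absz_nat modn_mod.
Qed.

Lemma zexpgN1 g : zexpg g (-1) = (g^-1)%g.
Proof.
by apply/eqP; rewrite eq_sym eq_invg_mul -{1}(zexpg1 g) -zexpgD subrr zexpg0.
Qed.

End group_powers.

Section abelian_products.
Context {gT : finGroupType}.
Hypothesis abT : abelian [set: gT]%SET.

Lemma abelian_mulgC : commutative (@mulg gT).
Proof. by move=> g h; apply: (centsP abT); rewrite inE. Qed.

(** Packages the multiplication as a commutative law, so that products over ['I_n] can be split and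
    reindexed. *)
Definition abelian_com_law : Monoid.com_law (1%g : gT) :=
  HB.pack (@mulg gT) (SemiGroup.isCommutativeLaw.Build gT mulg abelian_mulgC).

End abelian_products.

(** * Morphisms determined by their values on generators *)

Lemma morphg1 (G H : groupType) (f : G -> H) :
  {morph f : u v / (u * v)%g} -> f 1%g = 1%g.
Proof. by move=> fM; apply: (@mulgI _ (f 1%g)); rewrite -fM !mulg1. Qed.

Lemma morphgV (G H : groupType) (f : G -> H) :
  {morph f : u v / (u * v)%g} -> {morph f : u / (u^-1)%g}.
Proof.
by move=> fM u; apply: (@mulgI _ (f u)); rewrite -fM !mulgV (morphg1 fM).
Qed.

Lemma word_class_inv (n : nat) (i : 'I_n) :
  word_class [:: (i, true)] = ((gamma i)^-1)%g.
Proof.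
apply: (@mulgI _ (gamma i)); rewrite mulgV word_classM; apply/word_classP.
exact: (word_cancel [::] [::]).
Qed.

(** Both sides are multiplicative along a word representing [g], so agreement on its letters
    suffices. *)
Lemma chi_graph_morph (G H : groupType) (n : nat) (B : 'I_n -> G) (f : G -> H)
    (theta : {multiplicative Gamma n -> H}) :
  {morph f : u v / (u * v)%g} -> (forall i, f (B i) = theta (gamma i)) ->
  forall g u, chi_graph B g u -> f u = theta g.
Proof.
move=> fM fB _ _ [w -> ->].
have thM : {morph theta : u v / (u * v)%g} by move=> u v; rewrite gmulfM.
rewrite /word_eval; elim: w => [|[i b] w IH].
  by rewrite big_nil (morphg1 fM) -(morphg1 thM).
rewrite big_cons fM IH -cat1s -word_classM thM; congr mulg.
by case: b => //=; rewrite word_class_inv (morphgV fM) (morphgV thM) fB.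
Qed.

(** * The morphism built from the winding numbers *)

Section homological_extension.
Context {R : realType} {gT : finGroupType} {n : nat} (x : M0succ R n).
Variables (last : 'I_n) (s : {perm 'I_n}).
Variable (theta : {multiplicative Gamma n -> gT}).
Hypotheses (ln : last.+1 = n) (abT : abelian [set: gT]%SET).

Definition winding_product (u : pi1 R x) : gT :=
  (\prod_(j < n | j != last)
     zexpg (theta (gamma (s^-1 j))) (winding (difference j) u))%g.

(** Winding numbers are additive, and commutativity lets the two products be merged factor by
    factor. *)
Lemma winding_productM : {morph winding_product : u v / (u * v)%g}.
Proof.
move=> u v; have /= <- := @big_split _ _ (abelian_com_law abT).
apply: eq_bigr => j jl; rewrite -zexpgD.
by rewrite (windingM (ccont_difference ln jl) (difference_neq0 ln jl)).
Qed.

(** The relation of [Gamma n], mapped by [theta] and reordered by [s^-1], makes the factor at [last]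
    inverse to the product of the others. *)
Lemma theta_except_last :
  (\prod_(j < n | j != last) (theta (gamma (s^-1 j)))^-1)%g =
  theta (gamma (s^-1%g last)).
Proof.
have thM : {morph theta : u v / (u * v)%g} by move=> u v; rewrite gmulfM.
have all1 : (\prod_(j < n) theta (gamma (s^-1 j)))%g = 1%g.
  rewrite -[RHS](morphg1 thM) -(gamma_relation n).
  rewrite (big_morph _ thM (morphg1 thM)).
  exact: esym (@reindex_inj _ (abelian_com_law abT) 1%g _ _ xpredT
    (fun i => theta (gamma i)) (@perm_inj _ (s^-1)%g)).
have invM : {morph (@invg gT) : g h / (g * h)%g}.
  by move=> g h; rewrite invMg; exact: (abelian_mulgC abT).
rewrite -(big_morph _ invM (@invg1 gT)); apply/eqP; rewrite eq_invg_mul.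
have /= := @bigD1 _ (abelian_com_law abT) 1%g _ last xpredT
  (fun j => theta (gamma (s^-1 j)))%g.
by rewrite all1 (abelian_mulgC abT) => <-.
Qed.

Lemma winding_product_basis (B : 'I_n -> pi1 R (moving_point x)) i :
  (forall j, j != last ->
     winding (difference j) (pi1_map (fibre_incl x) (B i)) =
     if s i == j then 1 else if s i == last then -1 else 0) ->
  winding_product (pi1_map (fibre_incl x) (B i)) = theta (gamma i).
Proof.
move=> wB; have si : (s^-1)%g (s i) = i by rewrite permK.
have [sl|sl] := eqVneq (s i) last.
  rewrite -{2}si sl -theta_except_last; apply: eq_bigr => j jl.
  by rewrite wB // sl eqxx eq_sym (negbTE jl) zexpgN1.
apply: etrans (@bigD1 _ (abelian_com_law abT) 1%g _ (s i) (predC1 last) _ sl) _.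
rewrite /= wB // eqxx zexpg1 si big1 ?mulg1 // => j /andP[jl jsi].
by rewrite wB // eq_sym (negbTE jsi) (negbTE sl) zexpg0.
Qed.

End homological_extension.

(** * The extension defined on the whole group *)

Lemma is_subgroupT (G : groupType) : is_subgroup [set: G].
Proof. by []. Qed.

Lemma finite_indexT (G : groupType) : finite_index [set: G].
Proof.
apply: (@sub_finite_set _ _ [set setT]); last exact: finite_set1.
move=> _ [g _ <-]; apply/seteqP; split=> // h _.
by exists (g^-1 * h)%g; rewrite // mulVKg.
Qed.

Theorem theorem10p1 (R : realType) (gT : finGroupType) (n : nat)
    (hn : (3 <= n)%N) (x : M0succ R n)
    (B : 'I_n -> pi1 R (moving_point x)) (hB : geometric_basis B)
    (theta : {multiplicative Gamma n -> gT}) (htheta : n_datum theta)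
    (hG : abelian [set: gT]%SET) :
  exists a : extension B theta, ext_group a = [set: pi1 R (forget x)].
Proof.
(* Points are numbered from 0, so [last], the index of infinity, has value [n - 1]. *)
have [last ln] : exists last : 'I_n, last.+1 = n.
  case: n hn {x B hB theta htheta} => // m _.
  by exists ord_max.
have [s [c [r [tau [w [_ discs lassos]]]]]] := hB.
pose F := winding_product (x := x) last s theta.
have FM : {morph F : u v / (u * v)%g} by exact: winding_productM.
have FB i : F (pi1_map (fibre_incl x) (B i)) = theta (gamma i).
  have [l Bl lE] := lassos i.
  apply: winding_product_basis => // j jl.
  by rewrite Bl (winding_lasso ln discs lE jl).
have Fchi : forall (g : Gamma n) (u : pi1 R (moving_point x)),
    chi_graph B g u -> F (pi1_map (fibre_incl x) u) = theta g.
  apply: (@chi_graph_morph _ _ _ _ (F \o pi1_map (fibre_incl x))) => // u v.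
  by rewrite /= gmulfM FM.
by exists (Extension (is_subgroupT _) (finite_indexT _) (in2W FM) Fchi).
Qed.
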